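(* Let $\mathbf{M}=[\underline{M},\overline{M}]$ be an $m\times n$ interval matrix with entries $\mathbf{m}_{ij}=[\underline{m}_{ij},\overline{m}_{ij}]$. Then the following are equivalent: (1) $\mathbf{M}$ has the strong Monge property, i.e. every real matrix $M\in\mathbf{M}$ is Monge; (2) $\overline{m}_{ij}+\overline{m}_{k\ell}\le \underline{m}_{i\ell}+\underline{m}_{kj}$ for all $1\le i<k\le m$, $1\le j<\ell\le n$; (3) $\overline{m}_{ij}+\overline{m}_{i+1,j+1}\le \underline{m}_{i,j+1}+\underline{m}_{i+1,j}$ for all $1\le i<m$, $1\le j<n$; (4) both corner matrices $\downarrow M$ and $\uparrow M$ are Monge; (5) the interval-valued function $\mathbf{f}:I\to\mathbb{IR}$, $I=\{1,\dots,m\}\times\{1,\dots,n\}$, defined by $\mathbf{f}(i,j)=\mathbf{m}_{ij}$ is submodular on the lattice $\Lambda=(I,\wedge,\vee)$.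
   Context: An interval matrix $\mathbf{M}=[\underline{M},\overline{M}]$ with real $m\times n$ matrices $\underline{M}\le\overline{M}$ (entrywise) is the set $\{A\in\mathbb{R}^{m\times n}:\underline{M}\le A\le\overline{M}\}$; $\mathbb{IR}$ denotes the set of closed real intervals. A real matrix $A\in\mathbb{R}^{m\times n}$ is Monge if $a_{ij}+a_{k\ell}\le a_{i\ell}+a_{kj}$ for all $1\le i<k\le m$, $1\le j<\ell\le n$. The corner matrices are defined entrywise by $(\uparrow M)_{ij}=\overline{m}_{ij}$ and $(\downarrow M)_{ij}=\underline{m}_{ij}$ if $i+j$ is even, and $(\uparrow M)_{ij}=\underline{m}_{ij}$ and $(\downarrow M)_{ij}=\overline{m}_{ij}$ if $i+j$ is odd. On $I=\{1,\dots,m\}\times\{1,\dots,n\}$ define $(x_1,x_2)\wedge(y_1,y_2)=(\min\{x_1,y_1\},\min\{x_2,y_2\})$ and $(x_1,x_2)\vee(y_1,y_2)=(\max\{x_1,y_1\},\max\{x_2,y_2\})$. A function $\mathbf{f}:I\to\mathbb{IR}$, $\mathbf{f}(x)=[\underline{f}(x),\overline{f}(x)]$, is submodular on $\Lambda=(I,\wedge,\vee)$ if $\overline{f}(x\vee y)+\overline{f}(x\wedge y)\le\underline{f}(x)+\underline{f}(y)$ for all $x,y\in I$.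
   Formalization: In (5), submodularity is required only for incomparable x, y in I; required for all x, y it would force (at x = y) every interval to be a single point, so the equivalence would fail, e.g. for the 1×1 matrix [0,1]. *)

(* Defs.v *)
From HB Require Import structures.
From mathcomp Require Import all_boot all_order all_algebra.
From mathcomp Require Import reals.

Set Implicit Arguments.
Unset Strict Implicit.
Unset Printing Implicit Defensive.

Import Order.TTheory GRing.Theory Num.Theory.
Local Open Scope ring_scope.

Record closed_interval (R : realType) := ClosedInterval {
  lower : R;
  upper : R;
  lower_le_upper : lower <= upper }.

Definition mx_le (R : realType) (m n : nat) (A B : 'M[R]_(m, n)) : Prop :=
  forall i j, A i j <= B i j.

Record interval_matrix (R : realType) (m n : nat) := IntervalMatrix {
  lower_mx : 'M[R]_(m, n);
  upper_mx : 'M[R]_(m, n);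
  lower_mx_le_upper_mx : mx_le lower_mx upper_mx }.

Definition in_imx (R : realType) (m n : nat)
    (M : interval_matrix R m n) (A : 'M[R]_(m, n)) : Prop :=
  mx_le (lower_mx M) A /\ mx_le A (upper_mx M).

Definition imx_entry (R : realType) (m n : nat)
    (M : interval_matrix R m n) (i : 'I_m) (j : 'I_n) : closed_interval R :=
  ClosedInterval (lower_mx_le_upper_mx M i j).

Definition monge (R : realType) (m n : nat) (A : 'M[R]_(m, n)) : Prop :=
  forall (i k : 'I_m) (j l : 'I_n), (i < k)%N -> (j < l)%N ->
    A i j + A k l <= A i l + A k j.

Definition strong_monge (R : realType) (m n : nat)
    (M : interval_matrix R m n) : Prop :=
  forall A : 'M[R]_(m, n), in_imx M A -> monge A.

(* Indices start at 0 here and at 1 in the usual matrix convention; shifting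
   both indices by one leaves the parity of i + j unchanged. *)
Definition up_corner (R : realType) (m n : nat)
    (M : interval_matrix R m n) : 'M[R]_(m, n) :=
  \matrix_(i, j) if odd (i + j) then lower_mx M i j else upper_mx M i j.

Definition down_corner (R : realType) (m n : nat)
    (M : interval_matrix R m n) : 'M[R]_(m, n) :=
  \matrix_(i, j) if odd (i + j) then upper_mx M i j else lower_mx M i j.

(* Only incomparable x and y are constrained.  For comparable x and y the set
   {x `|` y, x `&` y} is {x, y}, and every real-valued function satisfies the
   submodular inequality with equality; imposing the endpoint inequality there
   would (already for x = y) force all values of f to be degenerate. *)
Definition interval_submodular (R : realType) (d : Order.disp_t)
    (L : latticeType d) (f : L -> closed_interval R) : Prop :=
  forall x y : L, (x >< y)%O ->
    upper (f (x `|` y)%O) + upper (f (x `&` y)%O) <= lower (f x) + lower (f y).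

(* The lattice operations of the index grid 'I_m *p 'I_n are the
   componentwise minimum and maximum. *)
Lemma grid_meetE (m n : nat) (x y : 'I_m *p 'I_n) :
  (x `&` y)%O = (Order.min x.1 y.1, Order.min x.2 y.2).
Proof. by rewrite Order.ProdOrder.meetEprod !meetEtotal. Qed.

Lemma grid_joinE (m n : nat) (x y : 'I_m *p 'I_n) :
  (x `|` y)%O = (Order.max x.1 y.1, Order.max x.2 y.2).
Proof. by rewrite Order.ProdOrder.joinEprod !joinEtotal. Qed.

Definition imx_fun (R : realType) (m n : nat) (M : interval_matrix R m n)
    (x : 'I_m *p 'I_n) : closed_interval R :=
  imx_entry M x.1 x.2.

(* Main.v *)
(* The Monge inequality of a rectangle is the sum of the inequalities of the
   unit cells it contains, so it suffices to check unit cells.  On a unit cell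
   the worst choice of entries in M takes upper bounds on the diagonal and lower
   bounds on the antidiagonal; by parity this choice is made by one of the two
   corner matrices.  Submodularity at an incomparable pair is the inequality of
   the rectangle having that pair as its antidiagonal. *)
Require Import Defs.
From HB Require Import structures.
From mathcomp Require Import all_boot all_order all_algebra.
From mathcomp Require Import reals lra.

Set Implicit Arguments.
Unset Strict Implicit.
Unset Printing Implicit Defensive.

Import Order.TTheory GRing.Theory Num.Theory.
Local Open Scope ring_scope.

(** Telescoping in two stages: [stripA] joins cells side by side within two adjacent rows, then such
    strips are stacked. In both inductions [d] is the index gap minus one, so [d = 0] is the
    adjacent case. *)
Lemma monge_from_unit_cells (R : realType) (m n : nat) (A : 'M[R]_(m, n)) :
  (forall (i i' : 'I_m) (j j' : 'I_n), i' = i.+1 :> nat -> j' = j.+1 :> nat ->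
     A i j + A i' j' <= A i j' + A i' j) ->
  monge A.
Proof.
move=> cellA.
have stripA (i i' : 'I_m) (j l : 'I_n) : i' = i.+1 :> nat -> (j < l)%N ->
    A i j + A i' l <= A i l + A i' j.
  move=> ii' jl; have [d def_l] : exists d, l = (j + d).+1 :> nat.
    by exists (l - j.+1)%N; rewrite -addSn subnKC.
  elim: d l {jl} def_l => [|d IHd] l def_l.
    by apply: cellA; rewrite // def_l addn0.
  (* The cut is made at the column just before [l], which is a valid index because [l] is. *)
  have lt_p : ((j + d).+1 < n)%N.
    by apply: ltn_trans (ltn_ord l); rewrite def_l addnS.
  have := IHd (Ordinal lt_p) erefl.
  have /= := cellA i i' (Ordinal lt_p) l ii'.
  by rewrite def_l addnS => /(_ erefl); lra.
move=> i k j l ik jl; have [d def_k] : exists d, k = (i + d).+1 :> nat.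
  by exists (k - i.+1)%N; rewrite -addSn subnKC.
elim: d k {ik} def_k => [|d IHd] k def_k.
  by apply: stripA; rewrite // def_k addn0.
have lt_p : ((i + d).+1 < m)%N.
  by apply: ltn_trans (ltn_ord k); rewrite def_k addnS.
have := IHd (Ordinal lt_p) erefl.
have := stripA (Ordinal lt_p) k j l _ jl.
by rewrite /= def_k addnS => /(_ erefl); lra.
Qed.

(** On each cell, a member of [M] is at most the upper bounds on the diagonal and at least the lower
    bounds on the antidiagonal. *)
Lemma strong_monge_from_unit_cells (R : realType) (m n : nat)
    (M : interval_matrix R m n) :
  (forall (i i' : 'I_m) (j j' : 'I_n), i' = i.+1 :> nat -> j' = j.+1 :> nat ->
     upper_mx M i j + upper_mx M i' j' <= lower_mx M i j' + lower_mx M i' j) ->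
  strong_monge M.
Proof.
move=> cellM A [geA leA]; apply: monge_from_unit_cells => i i' j j' ii' jj'.
have := cellM i i' j j' ii' jj'.
have := leA i j; have := leA i' j'; have := geA i j'; have := geA i' j.
lra.
Qed.

Lemma strong_monge_rectangle (R : realType) (m n : nat)
    (M : interval_matrix R m n) (i k : 'I_m) (j l : 'I_n) :
  strong_monge M -> (i < k)%N -> (j < l)%N ->
  upper_mx M i j + upper_mx M k l <= lower_mx M i l + lower_mx M k j.
Proof.
move=> smM ik jl.
(* The extremal member of [M] for this rectangle: upper bounds at the two diagonal corners only, so
   its Monge inequality there is the goal. *)
pose A : 'M[R]_(m, n) := \matrix_(a, b)
  if (a == i) && (b == j) || (a == k) && (b == l)
  then upper_mx M a b else lower_mx M a b.
have inA : in_imx M A.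
  by split=> a b; rewrite mxE; case: ifP => _ //; apply: lower_mx_le_upper_mx.
have ki : (k == i) = false by rewrite -val_eqE gtn_eqF.
have lj : (l == j) = false by rewrite -val_eqE gtn_eqF.
have := smM A inA i k j l ik jl.
by rewrite !mxE !eqxx ki lj ![_ == k]eq_sym ![_ == l]eq_sym ki lj.
Qed.

Lemma down_corner_in_imx (R : realType) (m n : nat)
    (M : interval_matrix R m n) : in_imx M (down_corner M).
Proof.
by split=> i j; rewrite mxE; case: ifP => _ //; apply: lower_mx_le_upper_mx.
Qed.

Lemma up_corner_in_imx (R : realType) (m n : nat)
    (M : interval_matrix R m n) : in_imx M (up_corner M).
Proof.
by split=> i j; rewrite mxE; case: ifP => _ //; apply: lower_mx_le_upper_mx.
Qed.

Lemma strong_monge_from_corners (R : realType) (m n : nat)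
    (M : interval_matrix R m n) :
  monge (down_corner M) -> monge (up_corner M) -> strong_monge M.
Proof.
move=> downM upM; apply: strong_monge_from_unit_cells => i i' j j' ii' jj'.
have lt_i : (i < i')%N by rewrite ii'.
have lt_j : (j < j')%N by rewrite jj'.
have := upM i i' j j' lt_i lt_j; have := downM i i' j j' lt_i lt_j.
(* Diagonal corners of a cell share the parity of [i + j], antidiagonal ones have the other: [downM]
   settles the odd case, [upM] the even one. *)
by rewrite !mxE ii' jj' !addSn !addnS /= negbK; case: (odd _).
Qed.

Lemma interval_submodular_imx_fun (R : realType) (m n : nat)
    (M : interval_matrix R m n) :
  interval_submodular (imx_fun M) <->
  (forall (i k : 'I_m) (j l : 'I_n), (i < k)%N -> (j < l)%N ->
     upper_mx M i j + upper_mx M k l <= lower_mx M i l + lower_mx M k j).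
Proof.
split=> [subM i k j l ik jl | rectM [i l] [k j]].
  have := subM (i, l) (k, j); rewrite grid_joinE grid_meetE /=.
  have le_ik : (i <= k)%O by rewrite leEord ltnW.
  have le_jl : (j <= l)%O by rewrite leEord ltnW.
  rewrite (max_r le_ik) (min_l le_ik) (max_l le_jl) (min_r le_jl).
  rewrite /= addrC; apply.
  rewrite /Order.comparable !Order.ProdOrder.leEprod /=.
  have -> : (l <= j)%O = false by rewrite leEord leqNgt jl.
  have -> : (k <= i)%O = false by rewrite leEord leqNgt ik.
  by rewrite andbF.
rewrite grid_joinE grid_meetE /Order.comparable !Order.ProdOrder.leEprod /=.
rewrite addrC.
(* Of the nine order patterns only two are incomparable, [i < k] with [j < l] and [k < i] with
   [l < j]; they differ by swapping the two points. *)
case: (ltgtP i k) => [ik|ki|->] /=; case: (ltgtP l j) => [lj|jl|->] //= _.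
- exact: rectM.
- by rewrite [leRHS]addrC; apply: rectM.
Qed.

Theorem theorem3p1 (R : realType) (m n : nat) (M : interval_matrix R m n) :
  [<-> strong_monge M;
       forall (i k : 'I_m) (j l : 'I_n), (i < k)%N -> (j < l)%N ->
         upper (imx_entry M i j) + upper (imx_entry M k l)
           <= lower (imx_entry M i l) + lower (imx_entry M k j);
       forall (i i' : 'I_m) (j j' : 'I_n),
         i' = i.+1 :> nat -> j' = j.+1 :> nat ->
         upper (imx_entry M i j) + upper (imx_entry M i' j')
           <= lower (imx_entry M i j') + lower (imx_entry M i' j);
       monge (down_corner M) /\ monge (up_corner M);
       interval_submodular (imx_fun M)].
Proof.
tfae.
- by move=> smM i k j l; apply: strong_monge_rectangle.
- by move=> rectM i i' j j' ii' jj'; apply: rectM; rewrite ?ii' ?jj'.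
- move=> /strong_monge_from_unit_cells smM.
  by split; apply: smM; [apply: down_corner_in_imx | apply: up_corner_in_imx].
(* The corners first give back the strong Monge property, which then yields every rectangle
   inequality. *)
- move=> [downM upM]; apply/interval_submodular_imx_fun => i k j l.
  exact/strong_monge_rectangle/strong_monge_from_corners.
- move=> /interval_submodular_imx_fun rectM.
  apply: strong_monge_from_unit_cells => i i' j j' ii' jj'.
  by apply: rectM; rewrite ?ii' ?jj'.
Qed.
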